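(* Let $q$ be a prime power, let $s,t$ be positive integers with $\gcd(s,t)=1$, and let $\ell>2$ be an integer with $\ell\mid q^t-1$. Let $\varepsilon\in\mathbb{F}_{q^t}$ be such that $\{1,\varepsilon,\varepsilon^2,\ldots,\varepsilon^{\ell-1}\}$ is the set of all roots of $X^\ell-1$, and let $\eta$ be a nonzero element of $E_1=\{x\in\mathbb{F}_{q^{\ell t}}\colon x^{q^t}=\varepsilon x\}$. Let $I$ be an $i$-dimensional $\mathbb{F}_q$-subspace of $\mathbb{F}_{q^t}$, $i\ge2$. Define $$T=T_{s,\eta,I}=\{x+\eta x^{q^s}\colon x\in I\}\subseteq\mathbb{F}_{q^{\ell t}}.$$ Then for any integer $k>1$, $L_{T^k}$ is a $\left(\frac{q^k-1}{q-1},i\right)$-regular fat linear set of rank $ki$ in $\mathrm{PG}(k-1,q^{\ell t})$. The points of weight $i$ are precisely the elements of $\mathrm{PG}(k-1,q)$, i.e. the points $(a_1:a_2:\ldots:a_k)$ with $(0,\ldots,0)\neq(a_1,\ldots,a_k)\in\mathbb{F}_q^k$.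
   Context: $T^k=T\times\cdots\times T\subseteq\mathbb{F}_{q^{\ell t}}^k$. With $E_j=\{x\in\mathbb{F}_{q^{\ell t}}\colon x^{q^t}-\varepsilon^jx=0\}$, each $E_j$ is a one-dimensional $\mathbb{F}_{q^t}$-subspace of $\mathbb{F}_{q^{\ell t}}$ and $E_j=\langle\eta^j\rangle_{\mathbb{F}_{q^t}}$ for $j=0,\ldots,\ell-1$. For an $\mathbb{F}_q$-subspace $U$ of $\mathbb{F}_{q^n}^k$ with $\dim_{\mathbb{F}_q}U=\rho$, the linear set of rank $\rho$ in $\mathrm{PG}(k-1,q^n)$ associated with $U$ is $L_U=\{\langle v\rangle_{\mathbb{F}_{q^n}}\colon v\in U,\ v\ne0\}$. The weight of a point $P=\langle v\rangle_{\mathbb{F}_{q^n}}$ is $w_{L_U}(P)=\dim_{\mathbb{F}_q}(\langle v\rangle_{\mathbb{F}_{q^n}}\cap U)$. The point $\langle(\alpha_1,\ldots,\alpha_k)\rangle_{\mathbb{F}_{q^n}}$ is denoted $(\alpha_1:\ldots:\alpha_k)$. For integers $r\ge0$, $i\ge2$, the linear set $L_U$ is $(r,i)$-regular fat if it has exactly $r$ points of weight $i$, all its remaining points have weight one, and there is at least one point of weight one. Here $n=\ell t$. *)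

(* Defs.v *)
From HB Require Import structures.
From mathcomp Require Import all_boot all_order all_algebra all_fingroup all_field.

Set Implicit Arguments.
Unset Strict Implicit.
Unset Printing Implicit Defensive.

Import GRing.Theory.
Local Open Scope ring_scope.

(* L^k carries two vector space structures, over F and over L. They live on
   the convertible types {ffun 'I_k -> L} and {ffun 'I_k -> L^o}.            *)

Definition vecF (F : fieldType) (L : fieldExtType F) (k : nat) : vectType F :=
  {ffun 'I_k -> L}.

Definition vecL (F : fieldType) (L : fieldExtType F) (k : nat) : vectType L :=
  {ffun 'I_k -> L^o}.

Section LinearSets.

Variables (F : fieldType) (L : fieldExtType F) (k : nat).

Definition mkvec (f : 'I_k -> L) : vecF L k := [ffun j => f j].

Definition coor (j : 'I_k) (u : vecF L k) : L := (u : {ffun 'I_k -> L}) j.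

Definition toL (u : vecF L k) : vecL L k := u.

Definition toF (v : vecL L k) : vecF L k := v.

(* The underlying F-subspace of an L-subspace; see mem_restrict_scalars. *)
Definition restrict_scalars (W : {vspace vecL L k}) : {vspace vecF L k} :=
  (\sum_(w <- vbasis W) limg (linfun (fun a : L => toF (a *: w))))%VS.

(* Points of PG(k-1, L) are represented as one-dimensional L-subspaces of L^k. *)
Definition point (u : vecF L k) : {vspace vecL L k} := <[toL u]>%VS.

Definition linear_set (U : {vspace vecF L k}) (P : {vspace vecL L k}) : Prop :=
  exists u : vecF L k, [/\ u \in U, u != 0 & P = point u].

Definition weight (U : {vspace vecF L k}) (P : {vspace vecL L k}) : nat :=
  \dim (restrict_scalars P :&: U)%VS.

Definition point_of_weight (U : {vspace vecF L k}) (w : nat)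
    (P : {vspace vecL L k}) : Prop :=
  linear_set U P /\ weight U P = w.

Definition regular_fat (r i : nat) (U : {vspace vecF L k}) : Prop :=
  [/\ (2 <= i)%N,
      exists ps : seq {vspace vecL L k},
        [/\ uniq ps, size ps = r
          & forall P, P \in ps <-> point_of_weight U i P],
      forall P, linear_set U P -> weight U P <> i -> weight U P = 1%N
    & exists P, point_of_weight U 1 P].

(* T x ... x T inside L^k; see mem_power_space. *)
Definition power_space (T : {vspace L}) : {vspace vecF L k} :=
  (\bigcap_(j < k) (linfun (coor j) @^-1: T))%VS.

Lemma scale_is_linear (w : vecL L k) :
  linear (fun a : L => toF (a *: w)).
Proof.
move=> c a b; rewrite /toF scalerDl; congr (_ + _).
by apply/ffunP=> j; rewrite !ffunE /= -[LHS]scalerAl.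
Qed.

Lemma mem_restrict_scalars (W : {vspace vecL L k}) (u : vecF L k) :
  (u \in restrict_scalars W) = (toL u \in W).
Proof.
have scE w a : linfun (fun a : L => toF (a *: w)) a = toF (a *: w).
  pose h := GRing.isLinear.Build F L (vecF L k) *:%R _ (scale_is_linear w).
  pose g : {linear L -> vecF L k} := HB.pack (fun a : L => toF (a *: w)) h.
  exact: (lfunE g a).
apply/idP/idP; rewrite /restrict_scalars.
  rewrite big_tnth => /memv_sumP[f memf ->].
  refine (@memv_suml L (vecL L k) _ _ _ _ W _) => i _.
  have /memv_imgP[a _ ->] := memf i isT; rewrite scE.
  by apply: (@memvZ L (vecL L k)); apply: vbasis_mem; apply: mem_tnth.
move=> uW; rewrite (coord_vbasis uW : u = _).
rewrite (big_nth 0) big_mkord size_tuple.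
apply: (@memv_sumr F (vecF L k)) => i _.
rewrite -[X in X \in _]scE; exact/memv_img/memvf.
Qed.

Lemma coor_is_linear (j : 'I_k) : linear (coor j).
Proof. by move=> c u v; rewrite /coor !ffunE. Qed.

Lemma mem_power_space (T : {vspace L}) (u : vecF L k) :
  (u \in power_space T) = [forall j, coor j u \in T].
Proof.
have cE j : linfun (coor j) u = coor j u.
  pose h := GRing.isLinear.Build F (vecF L k) L *:%R _ (coor_is_linear j).
  pose g : {linear vecF L k -> L} := HB.pack (coor j) h.
  exact: (lfunE g u).
rewrite /power_space memvE; apply/subv_bigcapP/forallP => H j.
  by have := H j isT; rewrite -memvE -memv_preim cE.
by move=> _; rewrite -memvE -memv_preim cE.
Qed.

End LinearSets.

(* {x + eta x^(q^s) | x in I} with q = #|F|; see mem_Tspace. *)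
Definition Tspace (F : finFieldType) (L : fieldExtType F) (s : nat) (eta : L)
    (I : {vspace L}) : {vspace L} :=
  (linfun (fun x : L => x + eta * x ^+ (#|F| ^ s)%N) @: I)%VS.

Section TspaceTheory.

Variables (F : finFieldType) (L : fieldExtType F) (s : nat) (eta : L).

Lemma Tspace_is_linear : linear (fun x : L => x + eta * x ^+ (#|F| ^ s)%N).
Proof.
move=> c x y.
have Fc (a : F) : a ^+ (#|F| ^ s)%N = a.
  by elim: s => [|m IHm]; rewrite ?expr1 // expnSr exprM IHm expf_card.
have pcharn : [pchar L].-nat (#|F| ^ s)%N.
  have [p p_pr pcharFp] := finPcharP F.
  rewrite (eq_pnat _ (pchar_lalg L)).
  rewrite (card_pprimeChar pcharFp) -expnM pnatX.
  by rewrite (eq_pnat _ (pcharf_eq pcharFp)) pnat_id.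
rewrite exprDn_pchar // exprZn Fc mulrDr scalerDr -scalerAr.
by rewrite addrACA.
Qed.

Lemma mem_Tspace (I : {vspace L}) (y : L) :
  reflect (exists2 x, x \in I & y = x + eta * x ^+ (#|F| ^ s)%N)
          (y \in Tspace s eta I).
Proof.
have TE x : linfun (fun x : L => x + eta * x ^+ (#|F| ^ s)%N) x
           = x + eta * x ^+ (#|F| ^ s)%N.
  pose h := GRing.isLinear.Build F L L *:%R _ Tspace_is_linear.
  pose g : {linear L -> L} := HB.pack (fun x : L => x + eta * x ^+ (#|F| ^ s)%N) h.
  exact: (lfunE g x).
by apply: (iffP memv_imgP) => -[x xI ->]; exists x => //; rewrite TE.
Qed.

End TspaceTheory.

(* Main.v *)
From HB Require Import structures.
Require Import Defs.
From mathcomp Require Import all_boot all_order all_algebra all_fingroup all_field.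
From mathcomp Require Import ring.

Set Implicit Arguments.
Unset Strict Implicit.
Unset Printing Implicit Defensive.

Import GRing.Theory.
Local Open Scope ring_scope.

(** Write q = #|F|, t = dim K, Q = q^s and g x = x + eta * x^Q, so that T = g(I).

    Everything rests on the independence of 1, eta, eta^2 over K
    ([eigen_indep]): they are eigenvectors of the q^t-power map for the
    eigenvalues 1, eps, eps^2, and these are distinct because eps has order
    l > 2 ([root_unity_generator_order]).

    Let u and w = c u be two vectors of T^k, with coordinates g(x_j) and
    g(y_j), and let x_0 != 0.  Comparing the coefficients of 1, eta and eta^2
    in g(x_0) g(y_j) = g(x_j) g(y_0) gives y_j = b x_j with b = y_0 / x_0, and
    then, with d = x_j / x_0, the factorisation (b^Q - b) (d^Q - d) = 0.  An
    element of K fixed by the q^s-power map lies in F, since s and t are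
    coprime, so either b is in F or d is ([proportional_Tspace]).

    Hence there are two kinds of points.  If some ratio x_j / x_0 is outside F,
    then b is in F for every such w, so that w = b u and the point <u> has
    weight 1.  If all the ratios are in F, then <u> = <a> for a nonzero
    a in F^k ([linear_set_dichotomy]); the multiples of a that lie in T^k are
    the y a with y in T, so <a> has weight dim T = dim I
    ([weight_base_point], [dim_Tspace]).  The points of the second kind are
    counted by vectors of F^k with first nonzero coordinate 1
    ([base_points_enum]), and two F-independent elements of I give a point of
    the first kind ([exists_weight_one_point]). *)

(** * Power maps and the independence of 1, eta, eta^2 *)

Section Arithmetic.

Variables (F : finFieldType) (L : fieldExtType F).

Lemma exprD_card n (x y : L) :
  (x + y) ^+ (#|F| ^ n)%N = x ^+ (#|F| ^ n)%N + y ^+ (#|F| ^ n)%N.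
Proof.
(* For eta = 1 the map defining T is x + x^(q^n), an additive map. *)
by have := @Tspace_is_linear F L n 1 1 x y; rewrite !scale1r !mul1r addrACA => /addrI.
Qed.

Lemma expr_card_alg n (a : F) : (a%:A : L) ^+ (#|F| ^ n)%N = a%:A.
Proof.
rewrite exprZn expr1n; congr (_ *: _).
by elim: n => [|n IHn]; rewrite ?expr1 // expnSr exprM IHn expf_card.
Qed.

Lemma expr_card_subfield (K : {subfield L}) x :
  x \in K -> x ^+ (#|F| ^ \dim K)%N = x.
Proof. by rewrite Fermat's_little_theorem => /eqP. Qed.

(** A Bezout relation u s = v t + 1 expresses the q-power map on K, up to the
    identity x^(q^t) = x, as an iterate of the q^s-power map. *)
Lemma fixed_coprime_in_base (K : {subfield L}) s x :
    (0 < s)%N -> coprime s (\dim K) -> x \in K ->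
  x ^+ (#|F| ^ s)%N = x -> x \in 1%VS.
Proof.
move=> s_gt0 co_s_t xK fixs.
have fixM n m : x ^+ (#|F| ^ n)%N = x -> x ^+ (#|F| ^ (m * n))%N = x.
  by move=> fixn; elim: m => [|m IHm]; rewrite ?expr1 // mulSn expnD exprM fixn.
case: (egcdnP (\dim K) s_gt0) => u v; rewrite (eqP co_s_t) => Duv _.
rewrite (Fermat's_little_theorem 1%AS) dimv1 expn1.
have := fixM s u fixs.
by rewrite Duv expnD exprM fixM ?expn1 ?expr_card_subfield // => ->.
Qed.

(** Put q^t - 1 = m l.  For x nonzero in K, x^m is an l-th root of unity, hence
    a power of eps, so eps^n = 1 makes all the m l nonzero elements of K roots
    of X^(m n) - 1, whence m l <= m n. *)
Lemma root_unity_generator_order (K : {subfield L}) l (eps : L) n :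
    (0 < n)%N -> (l %| #|F| ^ \dim K - 1)%N ->
    (forall x : L, root ('X^l - 1) x -> exists j : 'I_l, x = eps ^+ j) ->
  eps ^+ n = 1 -> (l <= n)%N.
Proof.
move=> n_gt0 /dvdnP[m Dm] genl epsn.
have q_gt1 : (1 < #|F| ^ \dim K)%N.
  by rewrite -(exp1n (\dim K)) ltn_exp2r ?adim_gt0 // card_finNzRing_gt1.
have lm_gt0 : (0 < m * l)%N by rewrite -Dm subn_gt0.
have m_gt0 : (0 < m)%N by move: lm_gt0; rewrite muln_gt0 => /andP[].
(* L viewed as a finite type, so that the elements of K can be listed. *)
pose T : finFieldType := finvect_type L.
pose D := [pred x : T | (x \in K) && (x != 0)].
pose rs : seq L := enum D.
have szrs : size rs = (m * l)%N.
  rewrite -Dm; transitivity #|D|; first by rewrite cardE.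
  have <- : #|[pred x : T | x \in K]| = (#|F| ^ \dim K)%N by exact: card_vspace.
  rewrite [in RHS](cardD1 (0 : T)) inE.
  have -> : ((0 : T) \in K) = true by exact: mem0v.
  by rewrite add1n subn1; apply: eq_card => x; rewrite !inE andbC.
rewrite -(leq_pmul2l m_gt0) -szrs; apply: max_unity_roots.
- by rewrite muln_gt0 m_gt0.
- apply/allP=> x.
  have -> : (x \in rs) = (x \in K) && (x != 0) by exact: (mem_enum D x).
  case/andP=> xK x0.
  have xu : root ('X^l - 1) (x ^+ m : L).
    rewrite rootE !hornerE -exprM -Dm subr_eq0 subn1.
    rewrite -(inj_eq (mulfI x0)) -exprS prednK ?(ltnW q_gt1) //.
    by rewrite expr_card_subfield ?mulr1.
  have [j Dj] := genl _ xu.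
  by apply/unity_rootP; rewrite exprM Dj exprAC epsn expr1n.
exact: enum_uniq.
Qed.

(** Eigenvectors for distinct eigenvalues: the q^t-power map is additive, fixes
    K pointwise and multiplies eta^j by eps^j, and 1, eps, eps^2 are distinct.
    Two successive eliminations remove A and then B. *)
Lemma eigen_indep (K : {subfield L}) (eps eta A B C : L) :
    eps \in K -> eps ^+ 2 != 1 ->
    eta != 0 -> eta ^+ (#|F| ^ \dim K)%N = eps * eta ->
    A \in K -> B \in K -> C \in K ->
  A + B * eta + C * eta ^+ 2 = 0 -> [/\ A = 0, B = 0 & C = 0].
Proof.
move=> epsK eps2 eta0 Deta AK BK CK e1.
set Q := (#|F| ^ \dim K)%N in Deta.
have frK x : x \in K -> x ^+ Q = x by apply: expr_card_subfield.
have eps1 : eps - 1 != 0.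
  by apply: contraNneq eps2 => /eqP; rewrite subr_eq0 => /eqP ->; rewrite expr1n.
have eta2 : (eta ^+ 2) ^+ Q = eps ^+ 2 * eta ^+ 2 by rewrite exprAC Deta exprMn.
have e2 : A + B * (eps * eta) + C * (eps ^+ 2 * eta ^+ 2) = 0.
  have /(congr1 (fun x => x ^+ Q)) := e1.
  by rewrite !exprD_card 2!exprMn eta2 Deta !frK ?mem0v.
have e3 : B + (eps + 1) * C * eta = 0.
  apply: (mulfI eps1); apply: (mulfI eta0); rewrite !mulr0.
  have : A + B * (eps * eta) + C * (eps ^+ 2 * eta ^+ 2)
          - (A + B * eta + C * eta ^+ 2) = 0 by rewrite e1 e2 subr0.
  by move=> <-; ring.
have e4 : B + (eps + 1) * C * (eps * eta) = 0.
  have /(congr1 (fun x => x ^+ Q)) := e3.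
  by rewrite exprD_card !exprMn Deta !frK ?mem0v ?rpredD ?mem1v.
have e5 : (eps ^+ 2 - 1) * eta * C = 0.
  have : B + (eps + 1) * C * (eps * eta) - (B + (eps + 1) * C * eta) = 0.
    by rewrite e3 e4 subr0.
  by move=> <-; ring.
have C0 : C = 0.
  by move/eqP: e5; rewrite !mulf_eq0 subr_eq0 (negPf eps2) (negPf eta0) => /eqP.
have B0 : B = 0 by move: e3; rewrite C0 mulr0 mul0r addr0.
by move: e1; rewrite B0 C0 !mul0r !addr0.
Qed.

(** The hypothesis says that two coordinates of one vector of T^k are
    proportional to the same coordinates of another.  Its coefficient of 1
    gives the proportionality of the parameters; its coefficient of eta, after
    substitution, is the product (b^Q - b) (d^Q - d) with b = y / x and
    d = x' / x. *)
Lemma proportional_Tspace (K : {subfield L}) (eps eta : L) s x x' y y' :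
    eps \in K -> eps ^+ 2 != 1 ->
    eta != 0 -> eta ^+ (#|F| ^ \dim K)%N = eps * eta ->
    (0 < s)%N -> coprime s (\dim K) ->
    x \in K -> x' \in K -> y \in K -> y' \in K -> x != 0 ->
    (x + eta * x ^+ (#|F| ^ s)%N) * (y' + eta * y' ^+ (#|F| ^ s)%N)
     = (x' + eta * x' ^+ (#|F| ^ s)%N) * (y + eta * y ^+ (#|F| ^ s)%N) ->
  y' = y / x * x' /\ (y / x \in 1%VS \/ x' / x \in 1%VS).
Proof.
move=> epsK eps2 eta0 Deta s_gt0 co_s xK x'K yK y'K x0.
set Q := (#|F| ^ s)%N => e.
have [] := @eigen_indep K eps eta (x * y' - x' * y)
  (x * y' ^+ Q + x ^+ Q * y' - (x' * y ^+ Q + x' ^+ Q * y))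
  (x ^+ Q * y' ^+ Q - x' ^+ Q * y ^+ Q) epsK eps2 eta0 Deta.
- by rewrite rpredB ?rpredM.
- by rewrite rpredB ?rpredD ?rpredM ?rpredX.
- by rewrite rpredB ?rpredM ?rpredX.
- move/eqP: e; rewrite -subr_eq0 => /eqP <-.
  by move: (x ^+ Q) (x' ^+ Q) (y ^+ Q) (y' ^+ Q) => *; ring.
move=> /eqP; rewrite subr_eq0 => /eqP e0 e1 _.
have Dy' : y' = y / x * x' by apply: (mulfI x0); rewrite e0; field.
split=> //; set c := y / x in Dy' *; set d := x' / x.
have Dy : y = c * x by rewrite /c; field.
have Dx' : x' = d * x by rewrite /d; field.
have : (c ^+ Q - c) * (d ^+ Q - d) * (x * x ^+ Q) = 0.
  rewrite -[RHS]e1 Dy' Dy Dx' !exprMn.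
  by move: (x ^+ Q) (c ^+ Q) (d ^+ Q) => *; ring.
move/eqP; rewrite !mulf_eq0 expf_eq0 (negPf x0) andbF !orbF !subr_eq0.
case/orP=> /eqP fixQ; [left | right];
  by apply: (fixed_coprime_in_base s_gt0 co_s _ fixQ); rewrite rpred_div.
Qed.

End Arithmetic.

(** * Points and weights over an arbitrary field *)

Lemma linfun_linearE (F : fieldType) (vT wT : vectType F) (f : vT -> wT) :
  linear f -> linfun f =1 f.
Proof.
move=> fL x; pose h := GRing.isLinear.Build F vT wT *:%R _ fL.
pose g : {linear vT -> wT} := HB.pack f h.
exact: (lfunE g x).
Qed.

Lemma ffun_neq0P (J : finType) (V : zmodType) (f : {ffun J -> V}) :
  reflect (exists j, f j != 0) (f != 0).
Proof.
apply: (iffP idP) => [f0|[j]]; last by apply: contraNneq => ->; rewrite ffunE.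
apply/existsP; apply: contraR f0; rewrite negb_exists => /forallP f0.
by apply/eqP/ffunP => j; rewrite ffunE; apply/eqP; rewrite -[_ == _]negbK f0.
Qed.

Section Points.

Variables (F : fieldType) (L : fieldExtType F) (k : nat).

Lemma coor_mkvec (f : 'I_k -> L) j : coor j (mkvec f) = f j.
Proof. by rewrite /coor ffunE. Qed.

Lemma eq_coor (u w : vecF L k) : (forall j, coor j u = coor j w) -> u = w.
Proof. by move=> e; apply/ffunP. Qed.

Lemma coorZ j (c : F) (u : vecF L k) : coor j (c *: u) = c *: coor j u.
Proof. by rewrite /coor ffunE. Qed.

Lemma vecF_neq0P (u : vecF L k) : reflect (exists j, coor j u != 0) (u != 0).
Proof. exact: ffun_neq0P. Qed.

Lemma mem_pointP (u w : vecF L k) :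
  reflect (exists c : L, forall j, coor j w = c * coor j u) (toL w \in point u).
Proof.
apply: (iffP (vlineP _ _)) => [[c Dw]|[c Dw]]; exists c.
  by move=> j; have := congr1 (fun v : vecL L k => coor j (toF v)) Dw; rewrite /coor !ffunE.
by apply: eq_coor => j; rewrite Dw /coor !ffunE.
Qed.

Lemma point_eq (u w : vecF L k) (c : L) :
  c != 0 -> (forall j, coor j w = c * coor j u) -> point w = point u.
Proof.
move=> c0 Dw; apply: subv_anti; apply/andP; split.
  by rewrite -[X in (X <= _)%VS]/(<[toL w]>%VS) -memvE; apply/mem_pointP; exists c.
rewrite -[X in (X <= _)%VS]/(<[toL u]>%VS) -memvE; apply/mem_pointP; exists c^-1.
by move=> j; rewrite Dw mulKf.
Qed.

(** The power space is the isomorphic image of the space of functions from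
    'I_k to T, whose dimension is known. *)
Lemma dim_power_space (T : {vspace L}) : \dim (power_space k T) = (k * \dim T)%N.
Proof.
pose f (g : {ffun 'I_k -> subvs_of T}) : vecF L k := mkvec (fun j => vsval (g j)).
have fL : linear f.
  by move=> c g h; apply: eq_coor => j; rewrite /coor !ffunE linearP.
have fE := linfun_linearE fL.
have -> : power_space k T = limg (linfun f).
  apply/vspaceP=> u; rewrite mem_power_space; apply/forallP/memv_imgP.
    move=> uT; exists [ffun j => vsproj T (coor j u)]; rewrite ?memvf // fE.
    by apply: eq_coor => j; rewrite coor_mkvec ffunE vsprojK.
  by case=> g _ -> j; rewrite fE coor_mkvec subvsP.
rewrite limg_dim_eq; last first.
  apply/eqP; suff /eqP-> : lker (linfun f) == 0%VS by rewrite capv0.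
  apply/lker0P=> g h; rewrite !fE => e; apply/ffunP=> j; apply: val_inj.
  by have := congr1 (coor j) e; rewrite !coor_mkvec.
by rewrite dimvf -[dim _]/(#|'I_k| * \dim T)%N card_ord.
Qed.

Definition base_vec (a : 'I_k -> F) : vecF L k := mkvec (fun j => (a j)%:A).

(** The multiple c a lies in T^k exactly when c lies in T, because the
    coordinates of a are scalars of F and at least one of them is nonzero. *)
Lemma weight_base_point (T : {vspace L}) (a : {ffun 'I_k -> F}) :
  a != 0 -> weight (power_space k T) (point (base_vec a)) = \dim T.
Proof.
move=> a0.
have /ffun_neq0P[j aj0] := a0.
pose f (y : L) : vecF L k := mkvec (fun j => a j *: y).
have fL : linear f.
  by move=> c y z; apply: eq_coor => m; rewrite /coor !ffunE scalerDr !scalerA mulrC.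
have fE := linfun_linearE fL.
rewrite /weight.
have -> : (restrict_scalars (point (base_vec a)) :&: power_space k T)%VS
          = (linfun f @: T)%VS.
  apply/vspaceP=> u; rewrite memv_cap mem_restrict_scalars mem_power_space.
  apply/andP/memv_imgP => [[/mem_pointP[c Du] /forallP uT]|[y yT ->]].
    have {}Du m : coor m u = a m *: c by rewrite Du coor_mkvec -scalerAr mulr1.
    exists c; last by rewrite fE; apply: eq_coor => m; rewrite Du coor_mkvec.
    by rewrite -[c]scale1r -(mulVf aj0) -scalerA -Du memvZ.
  rewrite fE; split; last by apply/forallP=> m; rewrite coor_mkvec memvZ.
  by apply/mem_pointP; exists y => m; rewrite !coor_mkvec -scalerAr mulr1.
apply: limg_dim_eq; apply/eqP.
suff /eqP-> : lker (linfun f) == 0%VS by rewrite capv0.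
apply/lker0P=> y z; rewrite !fE => /(congr1 (coor j)); rewrite !coor_mkvec.
exact: scalerI.
Qed.

Lemma base_point_linear_set (T : {vspace L}) (a : {ffun 'I_k -> F}) :
  a != 0 -> (0 < \dim T)%N -> linear_set (power_space k T) (point (base_vec a)).
Proof.
move=> a0 T0.
have /ffun_neq0P[j aj0] := a0.
pose y := vpick T.
have y0 : y != 0 by rewrite vpick0 -dimv_eq0 -lt0n.
exists (mkvec (fun j => a j *: y)); split.
- by rewrite mem_power_space; apply/forallP=> m; rewrite coor_mkvec memvZ ?memv_pick.
- by apply/vecF_neq0P; exists j; rewrite coor_mkvec scaler_eq0 negb_or aj0.
symmetry; apply: (point_eq y0) => m.
by rewrite !coor_mkvec -scalerAr mulr1.
Qed.

(** If the only L-multiples of u in U are its F-multiples, then the point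
    meets U in the F-line of u. *)
Lemma weight_one (U : {vspace vecF L k}) (u : vecF L k) :
    u \in U -> u != 0 ->
    (forall w c, w \in U -> (forall j, coor j w = c * coor j u) -> c \in 1%VS) ->
  weight U (point u) = 1%N.
Proof.
move=> uU u0 cF; rewrite /weight.
suff -> : (restrict_scalars (point u) :&: U)%VS = <[u]>%VS by rewrite dim_vline u0.
apply/vspaceP=> w; rewrite memv_cap mem_restrict_scalars.
apply/andP/vlineP => [[/mem_pointP[c Dw] wU]|[c ->]].
  have /vlineP[d Dc] := cF w c wU Dw; exists d.
  by apply: eq_coor => j; rewrite Dw Dc coorZ -scalerAl mul1r.
split; last exact: memvZ.
by apply/mem_pointP; exists c%:A => j; rewrite coorZ -scalerAl mul1r.
Qed.

End Points.

(** * Counting the points with coordinates in F *)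

Section BasePoints.

Variables (F : finFieldType) (L : fieldExtType F) (k : nat).

(** The first nonzero coordinate in the fixed order used by [pick]; since the
    choice depends only on the support of a, the pivot is homogeneous. *)
Definition pivot (a : {ffun 'I_k -> F}) : F :=
  if [pick j | a j != 0] is Some j then a j else 0.

(** The vectors of pivot 1 form a set N of normalised representatives: scaling
    is a bijection from F^* x N onto the nonzero vectors, which gives the
    size of N, and an L-multiple of a vector of N can only be normalised if
    the factor is 1. *)
Lemma base_points_enum :
  exists ps : seq {vspace vecL L k},
    [/\ uniq ps, size ps = ((#|F| ^ k - 1) %/ (#|F| - 1))%N
      & forall P, P \in ps <->
          exists a : {ffun 'I_k -> F}, a != 0 /\ P = point (base_vec L a)].
Proof.
pose N := [set a | pivot a == 1].
pose sc (c : F) (a : {ffun 'I_k -> F}) : {ffun 'I_k -> F} := [ffun j => c * a j].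
(* The factor c is taken in L: it comes from equality of L-points. *)
have pivE (a b : {ffun 'I_k -> F}) (c : L) :
    c != 0 -> (forall j, (a j)%:A = c * (b j)%:A) -> (pivot a)%:A = c * (pivot b)%:A.
  move=> c0 Da; rewrite /pivot.
  have e : (fun j => a j != 0) =1 (fun j => b j != 0).
    move=> j; have := congr1 (fun x => x == 0) (Da j).
    by rewrite /= mulf_eq0 !scaler_eq0 (negPf c0) oner_eq0 !orbF => ->.
  rewrite (eq_pick e); case: pickP => [j _|_]; first exact: Da.
  by rewrite scale0r mulr0.
have piv_sc c a : c != 0 -> pivot (sc c a) = c * pivot a.
  move=> c0; apply: (fmorph_inj (in_alg L)).
  rewrite rmorphM /=; apply: pivE; first by rewrite scaler_eq0 negb_or c0 oner_eq0.
  by move=> j; rewrite ffunE -scalerAl mul1r scalerA.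
have piv0 a : a != 0 -> pivot a != 0.
  rewrite /pivot; case: pickP => // a0 /eqP[]; apply/ffunP=> j.
  by rewrite ffunE; apply/eqP/negbFE/a0.
have N0 a : a \in N -> a != 0.
  rewrite inE; apply: contraTneq => ->; rewrite /pivot.
  by case: pickP => [j|_]; rewrite ?ffunE ?eqxx // eq_sym oner_eq0.
have cardN (T : finType) (z : T) : #|[set x | x != z]| = (#|T| - 1)%N.
  by rewrite subn1 -(cardsC1 z); apply: eq_card => x; rewrite !inE.
have szN : (#|N| * (#|F| - 1) = #|F| ^ k - 1)%N.
  transitivity #|[set a : {ffun 'I_k -> F} | a != 0]|; last first.
    by rewrite cardN card_ffun card_ord.
  have -> : (#|F| - 1)%N = #|[set c : F | c != 0]| by rewrite cardN.
  rewrite mulnC -cardsX.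
  rewrite -(@card_in_imset _ _ (fun x : F * {ffun 'I_k -> F} => sc x.1 x.2)).
    apply: eq_card => a; rewrite [RHS]inE; apply/imsetP/idP => [[[c b]]|a0].
      rewrite !inE /= => /andP[c0 /eqP b1] -> /=.
      apply: contraNneq (c0) => e; rewrite -[c]mulr1 -b1 -piv_sc // e /pivot.
      by case: pickP => [j|//]; rewrite ffunE eqxx.
    exists (pivot a, sc (pivot a)^-1 a).
      by rewrite !inE /= piv0 // piv_sc ?invr_eq0 ?piv0 // mulVf ?piv0 /=.
    by apply/ffunP=> j; rewrite !ffunE mulVKf ?piv0.
  move=> [c a] [d b]; rewrite !inE /= => /andP[c0 /eqP a1] /andP[d0 /eqP b1] e.
  have /(congr1 pivot) := e; rewrite !piv_sc // a1 b1 !mulr1 => cd.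
  congr (_, _) => //; apply/ffunP=> j; apply: (mulfI c0).
  by move/ffunP/(_ j): e; rewrite !ffunE -cd.
exists [seq point (base_vec L a) | a : {ffun _ -> _} <- enum N]; split.
- rewrite map_inj_in_uniq ?enum_uniq // => a b; rewrite !mem_enum => aN bN e.
  have [c Da] : exists c : L, forall j, (a j)%:A = c * (b j)%:A.
    have /mem_pointP[c Da] : toL (base_vec L a) \in point (base_vec L b).
      by rewrite -e memv_line.
    by exists c => j; have := Da j; rewrite !coor_mkvec.
  have c0 : c != 0.
    apply: contraTneq (N0 a aN) => c0; rewrite negbK; apply/eqP/ffunP=> j.
    by apply: (fmorph_inj (in_alg L)); rewrite /= Da c0 mul0r ffunE scale0r.
  have := pivE a b c c0 Da; move: aN bN; rewrite !inE => /eqP-> /eqP->.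
  rewrite scale1r mulr1 => c1; apply/ffunP=> j.
  by apply: (fmorph_inj (in_alg L)); rewrite /= Da -c1 mul1r.
- by rewrite size_map -cardE -szN mulnK // subn_gt0 card_finNzRing_gt1.
move=> P; split=> [/mapP[a]|[a [a0 ->]]].
  by rewrite mem_enum => aN ->; exists a; split=> //; apply: N0.
have p0 := piv0 a a0; apply/mapP; exists (sc (pivot a)^-1 a).
  by rewrite mem_enum inE piv_sc ?invr_eq0 // mulVf.
apply: (@point_eq _ _ _ _ _ (pivot a)%:A).
  by rewrite scaler_eq0 negb_or p0 oner_eq0.
by move=> j; rewrite !coor_mkvec ffunE -scalerAl mul1r scalerA mulVKf.
Qed.

End BasePoints.

(** * The points of the linear set of T^k *)

Section TspacePower.

Variables (F : finFieldType) (L : fieldExtType F) (K : {subfield L}).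
Variables (eps eta : L) (s k : nat) (I : {vspace L}).
Hypotheses (epsK : eps \in K) (eps2 : eps ^+ 2 != 1).
Hypotheses (eta0 : eta != 0) (Deta : eta ^+ (#|F| ^ \dim K)%N = eps * eta).
Hypotheses (s_gt0 : (0 < s)%N) (co_s : coprime s (\dim K)) (sIK : (I <= K)%VS).

Let g (x : L) := x + eta * x ^+ (#|F| ^ s)%N.
Let U := power_space k (Tspace s eta I).

Let IK x : x \in I -> x \in K. Proof. exact: (subvP sIK). Qed.

Lemma Tspace_map_eq0 x : x \in K -> g x = 0 -> x = 0.
Proof.
move=> xK gx0.
by have [] := eigen_indep epsK eps2 eta0 Deta xK
  (rpredX (#|F| ^ s)%N xK) (mem0v K) (_ : _ = 0); rewrite // mul0r addr0 mulrC.
Qed.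

Lemma dim_Tspace : \dim (Tspace s eta I) = \dim I.
Proof.
apply: limg_dim_eq; apply/eqP; rewrite -subv0; apply/subvP=> x.
rewrite memv_cap memv_ker => /andP[/IK xK].
rewrite (linfun_linearE (@Tspace_is_linear F L s eta)) => /eqP/(Tspace_map_eq0 xK)->.
exact: mem0v.
Qed.

Lemma power_Tspace_param (u : vecF L k) :
  u \in U -> exists x : 'I_k -> L, forall j, x j \in I /\ coor j u = g (x j).
Proof.
rewrite mem_power_space => /forallP uT.
suff : forall j, exists x : L, x \in I /\ coor j u = g x by apply: fin_all_exists.
by move=> j; have /mem_Tspace[x xI Du] := uT j; exists x.
Qed.

(** The index j1 of the irrational ratio excludes the second alternative of
    [proportional_Tspace], which forces y_j0 / x_j0 into F for every multiple
    of u in T^k. *)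
Lemma weight_one_of_irrational (u : vecF L k) (x : 'I_k -> L) j0 j1 :
    u \in U -> (forall j, x j \in I /\ coor j u = g (x j)) ->
    x j0 != 0 -> x j1 / x j0 \notin 1%VS ->
  weight U (point u) = 1%N.
Proof.
move=> uU Dx x0 irr.
have xI j : x j \in I by case: (Dx j).
have Du j : coor j u = g (x j) by case: (Dx j).
have g0 : g (x j0) != 0 by apply: contraNneq x0 => /(Tspace_map_eq0 (IK (xI j0)))->.
apply: weight_one => //; first by apply/vecF_neq0P; exists j0; rewrite Du.
move=> w c wU Dw; have [y Dy] := power_Tspace_param wU.
have yI j : y j \in I by case: (Dy j).
have prop j := @proportional_Tspace F L K eps eta s (x j0) (x j) (y j0) (y j)
  epsK eps2 eta0 Deta s_gt0 co_s (IK (xI _)) (IK (xI _)) (IK (yI _)) (IK (yI _)) x0.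
have {}prop j : y j = y j0 / x j0 * x j /\
    (y j0 / x j0 \in 1%VS \/ x j / x j0 \in 1%VS).
  apply: prop; rewrite -!/(g _) -!(proj2 (Dy _)) !Dw !Du; ring.
have rat : y j0 / x j0 \in 1%VS.
  by case: (prop j1) => _ [] // r; rewrite r in irr.
suff -> : c = y j0 / x j0 by [].
apply: (mulIf g0); rewrite -Du -Dw (proj2 (Dy _)) /g.
have /vlineP[d Dd] := rat; have Dy0 : y j0 = d%:A * x j0 by rewrite -Dd divfK.
rewrite Dd Dy0 exprMn expr_card_alg.
by rewrite mulrCA -mulrDr Du.
Qed.

(** When x_j = a_j x_j0 with a_j in F, also g(x_j) = a_j g(x_j0), because the
    power map x^Q is F-linear. *)
Lemma base_point_of_rational (u : vecF L k) (x : 'I_k -> L) j0 :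
    u != 0 -> (forall j, x j \in I /\ coor j u = g (x j)) ->
    x j0 != 0 -> (forall j, x j / x j0 \in 1%VS) ->
  exists a : {ffun 'I_k -> F}, a != 0 /\ point u = point (base_vec L a).
Proof.
move=> u0 Dx x0 rat.
have [a Da] : exists a : 'I_k -> F, forall j, x j / x j0 = (a j)%:A.
  by apply: (fin_all_exists (P := fun j a => x j / x j0 = a%:A)) => j; apply/vlineP.
have Du j : coor j u = g (x j0) * (a j)%:A.
  rewrite (proj2 (Dx j)) -[x j](divfK x0) Da /g exprMn expr_card_alg.
  by rewrite mulrCA -mulrDr mulrC.
exists (finfun a); split.
  have [j uj0] := vecF_neq0P _ u0; apply: contraNneq uj0 => a0.
  by rewrite Du -[a j]ffunE a0 ffunE scale0r mulr0.
apply: (@point_eq _ _ _ _ _ (g (x j0))) => [|j]; last by rewrite coor_mkvec ffunE Du.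
have [j uj0] := vecF_neq0P _ u0; apply: contraNneq uj0 => g0.
by rewrite Du g0 mul0r.
Qed.

Lemma linear_set_dichotomy (P : {vspace vecL L k}) :
    linear_set U P ->
  weight U P = 1%N \/
  exists a : {ffun 'I_k -> F}, a != 0 /\ P = point (base_vec L a).
Proof.
case=> u [uU u0 ->]; have [x Dx] := power_Tspace_param uU.
have [j0 uj0] := vecF_neq0P _ u0.
have x0 : x j0 != 0.
  apply: contraNneq uj0 => x0; rewrite (proj2 (Dx j0)) x0 /g.
  by rewrite expr0n expn_eq0 -leqn0 leqNgt (ltnW (card_finNzRing_gt1 F)) mulr0 addr0.
case: (boolP [forall j, x j / x j0 \in 1%VS]) => [/forallP rat|].
  by right; apply: base_point_of_rational u0 Dx x0 rat.
rewrite negb_forall => /existsP[j1 irr].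
by left; apply: weight_one_of_irrational uU Dx x0 irr.
Qed.

(** Take z and z' independent over F in I and the vector with coordinate g(z)
    at the index 0 and g(z') elsewhere: the ratio z' / z is outside F. *)
Lemma exists_weight_one_point :
  (2 <= \dim I)%N -> (1 < k)%N -> exists P, point_of_weight U 1 P.
Proof.
move=> dimI k_gt1.
pose z := vpick I.
have z0 : z != 0 by rewrite vpick0 -dimv_eq0 -lt0n ltnW.
have /subvPn[z' z'I irr] : ~~ (I <= <[z]>)%VS.
  by apply: contraL dimI => /dimvS; rewrite dim_vline z0 -ltnNge.
pose j0 := Ordinal (ltnW k_gt1); pose j1 := Ordinal k_gt1.
pose x j := if j == j0 then z else z'.
have xI j : x j \in I by rewrite /x; case: ifP => // _; apply: memv_pick.
pose u : vecF L k := mkvec (fun j => g (x j)).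
have Dx j : x j \in I /\ coor j u = g (x j) by rewrite coor_mkvec.
have uU : u \in U.
  rewrite mem_power_space; apply/forallP=> j; apply/mem_Tspace.
  by exists (x j); case: (Dx j).
have u0 : u != 0.
  apply/vecF_neq0P; exists j0; rewrite coor_mkvec /x eqxx.
  by apply: contraNneq z0 => /(Tspace_map_eq0 (IK (memv_pick I)))/eqP.
exists (point u); split; first by exists u.
apply: (@weight_one_of_irrational u x j0 j1) => //; rewrite /x eqxx //=.
apply: contra irr => /vlineP[c Dc]; apply/vlineP; exists c.
by rewrite -[z'](divfK z0) Dc -scalerAl mul1r.
Qed.

End TspacePower.

Theorem theorem3p9 (F : finFieldType) (s t l : nat)
    (L : fieldExtType F) (K : {subfield L}) (eps eta : L)
    (i : nat) (I : {vspace L}) (k : nat)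
    (hs : (0 < s)%N) (ht : (0 < t)%N) (hst : coprime s t)
    (hl : (2 < l)%N) (hlq : (l %| #|F| ^ t - 1)%N)
    (hL : \dim {:L} = (l * t)%N) (hK : \dim K = t)
    (heps : eps \in K)
    (hroots : forall x : L,
       root ('X^l - 1) x <-> exists j : 'I_l, x = eps ^+ j)
    (heta0 : eta != 0) (heta : eta ^+ (#|F| ^ t)%N = eps * eta)
    (hI : (I <= K)%VS) (hdimI : \dim I = i) (hi : (2 <= i)%N)
    (hk : (1 < k)%N) :
  let T := Tspace s eta I in
  [/\ regular_fat ((#|F| ^ k - 1) %/ (#|F| - 1))%N i (power_space k T),
      \dim (power_space k T) = (k * i)%N
    & forall P : {vspace vecL L k},
        point_of_weight (power_space k T) i P <->
        exists a : {ffun 'I_k -> F},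
          a != 0 /\ P = point (mkvec (fun j => (a j)%:A))].
Proof.
move=> T; subst t i.
have eps2 : eps ^+ 2 != 1.
  apply: contraL hl => /eqP eps2; rewrite -leqNgt.
  by apply: (@root_unity_generator_order F L K l eps 2 isT hlq _ eps2) => x /hroots.
have dimT : \dim T = \dim I := dim_Tspace s heps eps2 heta0 heta hI.
have dich P : linear_set (power_space k T) P -> _ :=
  @linear_set_dichotomy _ _ _ _ _ _ _ _ heps eps2 heta0 heta hs hst hI P.
have heavy (P : {vspace vecL L k}) :
    point_of_weight (power_space k T) (\dim I) P <->
    exists a : {ffun 'I_k -> F}, a != 0 /\ P = point (base_vec L a).
  split=> [[PU wP]|[a [a0 ->]]].
    by case: (dich P PU) => // w1; move: hi; rewrite -wP w1.
  split; last by rewrite weight_base_point.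
  by apply: base_point_linear_set; rewrite ?dimT ?(ltnW hi).
split=> //; last by rewrite dim_power_space dimT.
split=> //.
- have [ps [ps_uniq ps_size memps]] := base_points_enum L k.
  exists ps; split=> // P.
  exact: iff_trans (memps P) (iff_sym (heavy P)).
- move=> P PU wP; case: (dich P PU) => // rat; case: wP.
  by case: (proj2 (heavy P) rat).
exact: (exists_weight_one_point heps eps2 heta0 heta hs hst hI hi hk).
Qed.
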